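(* An infinite dimensional Banach space $X$ with non-trivial cotype cannot have a semi-normalized basis having the NQP. In particular, $\ell_1$ does not have a semi-normalized basis with the NQP.
   Context: All Banach spaces are real; ''basis'' means Schauder basis; a basis $(x_i)$ is semi-normalized if $0<\inf_i\|x_i\|\le\sup_i\|x_i\|<\infty$. $X$ has non-trivial cotype if for some $2\le q<\infty$ there is $c<\infty$ such that for all $n$ and $v_1,\ldots,v_n\in X$: $\big(\sum_{i=1}^n\|v_i\|^q\big)^{1/q}\le c\big(2^{-n}\sum_{(\sigma_i)\in\{\pm1\}^n}\|\sum_{i=1}^n\sigma_iv_i\|^2\big)^{1/2}$. A basis $(x_i)_{i\in\mathbb{N}}$ of $X$ has the NQP (Net Quantization Property) if there are $\varepsilon>0$ and $\delta>0$ such that for every $x=\sum_{i\in E}a_ix_i$ with $E\subset\mathbb{N}$ finite and $a_i\in\mathbb{R}$, there is a finitely supported sequence $(k_i)\subset\mathbb{Z}$ with $\|x-\sum k_i\delta x_i\|\le\varepsilon$. *)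

(* Defs.v *)
From HB Require Import structures.
From mathcomp Require Import all_boot all_order all_algebra.
From mathcomp Require Import all_classical all_reals all_analysis.

Set Implicit Arguments.
Unset Strict Implicit.
Unset Printing Implicit Defensive.

Import Order.TTheory GRing.Theory Num.Theory.
Import numFieldNormedType.Exports.

Local Open Scope classical_set_scope.
Local Open Scope ring_scope.

Section BanachSpaceNotions.
Context {R : realType}.

Definition infinite_dimensional (X : lmodType R) : Prop :=
  ~ exists (n : nat) (v : 'I_n -> X),
      forall x : X, exists a : 'I_n -> R, x = \sum_(i < n) a i *: v i.

(* The sign sequence (sigma_i) is encoded by booleans: sigma_i = (-1) ^+ s i. *)
Definition cotype (q : R) (X : normedModType R) : Prop :=
  exists c : R, forall (n : nat) (v : 'I_n -> X),
    (\sum_(i < n) `|v i| `^ q) `^ q^-1 <=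
    c * Num.sqrt (2 ^- n * \sum_(s : {ffun 'I_n -> bool})
                             `|\sum_(i < n) (-1) ^+ s i *: v i| ^+ 2).

Definition nontrivial_cotype (X : normedModType R) : Prop :=
  exists q : R, 2 <= q /\ cotype q X.

Definition schauder_basis (X : normedModType R) (e : nat -> X) : Prop :=
  forall x : X, exists! a : nat -> R,
    series (fun i => a i *: e i) @ \oo --> x.

(* The infimum and supremum are extended reals, since the real-valued sup of an
   unbounded set is a default value. *)
Definition semi_normalized (X : normedModType R) (e : nat -> X) : Prop :=
  (0 < ereal_inf (range (fun i => `|e i|%:E)))%E /\
  (ereal_sup (range (fun i => `|e i|%:E)) < +oo)%E.

Definition NQP (X : normedModType R) (e : nat -> X) : Prop :=
  exists eps delta : R, [/\ 0 < eps, 0 < delta &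
    forall (E : set nat) (a : nat -> R), finite_set E ->
    exists2 k : nat -> int, finite_set [set i | k i != 0] &
      `|\sum_(i \in E) a i *: e i -
        \sum_(i \in [set i | k i != 0]) ((k i)%:~R * delta) *: e i| <= eps].

End BanachSpaceNotions.

Section Ell1.
Context {R : realType}.
Implicit Types f g : nat -> R.

Definition ell1_pred : {pred nat -> R} :=
  fun f => `[< cvgn [normed series f] >].

Lemma ell1_predP f :
  reflect (cvgn [normed series f]) (f \in ell1_pred).
Proof. exact: asboolP. Qed.

Lemma ell1_submod_closed : submod_closed ell1_pred.
Proof.
split.
  apply/ell1_predP; rewrite (_ : [normed series _] = cst 0).
    exact: is_cvg_cst.
  by apply/funext => n; rewrite /normed_series_of /series/= big1// => i _;
    rewrite normr0.
move=> a f g /ell1_predP cf /ell1_predP cg; apply/ell1_predP.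
have cag : cvgn (series (`|a| *: (fun i => `|f i|) + (fun i => `|g i|))).
  by apply: is_cvg_seriesD => //; exact: is_cvg_seriesZ.
apply: (series_le_cvg _ _ _ cag) => n //=.
  by rewrite addr_ge0// mulr_ge0.
by rewrite (le_trans (ler_normD _ _))// lerD2r normrM.
Qed.

HB.instance Definition _ :=
  GRing.isSubmodClosed.Build R (nat -> R) ell1_pred ell1_submod_closed.
End Ell1.

Record ell1 (R : realType) := Ell1 {
  ell1_fun :> nat -> R ;
  _ : ell1_fun \in ell1_pred }.

HB.instance Definition _ (R : realType) := [isSub for @ell1_fun R].
HB.instance Definition _ (R : realType) := [Choice of ell1 R by <:].
HB.instance Definition _ (R : realType) :=
  [SubChoice_isSubLmodule of ell1 R by <:].

Section Ell1Norm.
Context {R : realType}.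
Implicit Types x y : ell1 R.

Definition ell1_norm x : R := limn [normed series (x : nat -> R)].

Lemma ell1_cvg x : cvgn [normed series (x : nat -> R)].
Proof. by apply/ell1_predP; exact: (valP x). Qed.

Lemma ell1_norm_ge x n : \sum_(0 <= i < n) `|x i| <= ell1_norm x.
Proof.
apply: (@nondecreasing_cvgn_le _ [normed series (x : nat -> R)]).
  by apply: nondecreasing_series => i _ _; exact: normr_ge0.
exact: ell1_cvg.
Qed.

Lemma ell1_normP x (M : R) :
  (forall n, \sum_(0 <= i < n) `|x i| <= M) -> ell1_norm x <= M.
Proof.
move=> xM; apply: limr_le; first exact: ell1_cvg.
by apply: nearW => n; exact: xM.
Qed.

Lemma ell1_normD x y : ell1_norm (x + y) <= ell1_norm x + ell1_norm y.
Proof.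
apply: ell1_normP => n; apply: (@le_trans _ _
    (\sum_(0 <= i < n) `|x i| + \sum_(0 <= i < n) `|y i|)).
  by rewrite -big_split/=; apply: ler_sum => i _; exact: ler_normD.
by apply: lerD; exact: ell1_norm_ge.
Qed.

Lemma ell1_normZ (a : R) x : ell1_norm (a *: x) = `|a| * ell1_norm x.
Proof.
rewrite [RHS](_ : _ = `|a| *: limn (series (fun i => `|x i|)))//.
rewrite -lim_seriesZ; last exact: ell1_cvg.
rewrite /ell1_norm; congr (limn _); apply/funext => n.
rewrite /normed_series_of /series/=.
by apply: eq_bigr => i _; rewrite normrM.
Qed.

Lemma ell1_norm_eq0 x : ell1_norm x = 0 -> x = 0.
Proof.
move=> x0; apply/val_inj/funext => n; apply/eqP; rewrite -normr_le0 -x0.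
apply: le_trans (ell1_norm_ge x n.+1).
by rewrite big_nat_recr//= lerDr sumr_ge0.
Qed.

HB.instance Definition _ := @Lmodule_isNormed.Build R (ell1 R)
  ell1_norm ell1_normD ell1_normZ ell1_norm_eq0.

End Ell1Norm.

Section Ell1Complete.
Context {R : realType}.

Lemma ell1_coord_le (x : ell1 R) n : `|x n| <= `|x|.
Proof.
apply: le_trans (ell1_norm_ge x n.+1).
by rewrite big_nat_recr//= lerDr sumr_ge0.
Qed.

Lemma ell1_complete (F : set_system (ell1 R)) :
  ProperFilter F -> cauchy F -> cvg F.
Proof.
move=> FF Fcau; have Fc : cauchy_ex F by apply/cauchyP.
pose coord n (x : ell1 R) : R := x n.
have coord_cvg n : cvg (coord n @ F).
  apply/cauchy_cvgP/cauchyP => e e0; have [x Fx] := Fc _ e0.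
  exists (x n); rewrite /fmap/= nbhs_simpl; apply: filterS Fx => y.
  rewrite -!ball_normE /ball_/= => xy; apply: le_lt_trans xy.
  exact: (ell1_coord_le (x - y) n).
pose g n : R := lim (coord n @ F).
have sub_g (e : R) : 0 < e ->
    F [set x : ell1 R | forall N, \sum_(0 <= i < N) `|x i - g i| <= e].
  move=> e0; have e20 : 0 < e / 2 by rewrite divr_gt0.
  have [z Fz] := Fc _ e20; apply: filterS (Fz) => x zx N.
  have sum_cvg : (fun y : ell1 R => \sum_(0 <= i < N) `|x i - y i|) @ F -->
      \sum_(0 <= i < N) `|x i - g i|.
    elim: N => [|N IH].
      by rewrite big_nil; under eq_fun do rewrite big_nil; exact: cvg_cst.
    rewrite big_nat_recr//=; under eq_fun do rewrite big_nat_recr//=.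
    apply: cvgD => //; apply: cvg_norm; apply: cvgB; first exact: cvg_cst.
    exact: coord_cvg.
  apply: (cvgr_to_le sum_cvg); apply: filterS Fz => y zy.
  apply: le_trans (ell1_norm_ge (x - y) N) _.
  have : ball x e y by exact: ball_splitr zx zy.
  by rewrite -ball_normE /ball_/= => /ltW.
have g_ell1 : g \in ell1_pred.
  have /filter_ex[x xg] := sub_g _ ltr01.
  have xg_ell1 : (x : nat -> R) - g \in ell1_pred.
    apply/ell1_predP; apply: nondecreasing_is_cvgn.
      by apply: nondecreasing_series => i _ _; exact: normr_ge0.
    by exists 1 => _ [n _ <-]; exact: xg.
  by rewrite -[g](subKr (x : nat -> R)) rpredB//; exact: (valP x).
apply/cvg_ex; exists (Ell1 g_ell1); apply/cvgrPdist_le => e e0.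
apply: filterS (sub_g _ e0) => x xg; rewrite distrC.
exact: ell1_normP.
Qed.

HB.instance Definition _ := Uniform_isComplete.Build (ell1 R) ell1_complete.

End Ell1Complete.

(* Main.v *)
(* Suppose [e] is a semi-normalized basis with the NQP. By Banach's theorem the initial
   partial sums are uniformly bounded, so the net property passes to the span of the first
   [n] vectors, and approximating half-lattice points gives, for every parity pattern
   [s] in {0, 1}^n, integers [z_i] congruent to [s_i] mod 2 with |sum_(i < n) z_i e_i| <= C
   (after rescaling [e]). The [z_i] are bounded by some [N] independent of [n], and the 2^n
   words obtained are distinct, so by Natarajan's version of the Sauer-Shelah lemma they
   shatter a set of [d] coordinates with [n = d ^ 2]: there is f : {-1, 1}^d -> X bounded by
   [C] whose values have, in the [j]-th shattered coordinate, one of two distinct integers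
   chosen by the [j]-th sign. The Rademacher coefficients [v_j] of [f] are then bounded
   below.

   As in Pisier's estimate of the K-convexity constant of an n-dimensional space, the
   average of |sum_j +-v_j| ^ 2 is small: the Rademacher projection is approximated by a
   linear combination of noise operators, which are contractions on X-valued functions,
   and the error is estimated coordinatewise in L2. The combination can be chosen so that the
   root mean square of |sum_j +-v_j| is O(d ^ (1 / (2 Q))) for an integer Q > q, whereas
   cotype q forces it to be at least a multiple of d ^ (1 / q).

   The space l1 has cotype 2 by the L1 Khintchine inequality and Minkowski's inequality. *)
Require Import Defs.
From HB Require Import structures.
From mathcomp Require Import all_boot all_order all_algebra.
From mathcomp Require Import all_classical all_reals all_analysis.
From mathcomp Require Import ring lra zify.

Set Implicit Arguments.
Unset Strict Implicit.
Unset Printing Implicit Defensive.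

Import Order.TTheory GRing.Theory Num.Theory.
Import numFieldNormedType.Exports.

(** * Shattering *)

Section Shattering.
Variables (A : finType) (x0 : A).

(* Natarajan's notion: the coordinates [idx j], [j < d], take the two distinct letters
   [g false j] and [g true j] independently; nothing is required of [j >= d]. *)
Definition shatters (n d : nat) (F : {set n.-tuple A}) : Prop :=
  exists (idx : nat -> nat) (g : bool -> nat -> A) (h : (nat -> bool) -> n.-tuple A),
    (forall s, h s \in F) /\ forall j, (j < d)%N ->
      [/\ (idx j < n)%N, g false j != g true j &
          forall s, nth x0 (h s) (idx j) = g (s j) j].

Definition tails n (F : {set n.+1.-tuple A}) : {set n.-tuple A} :=
  [set t : n.-tuple A | [exists a : A, [tuple of a :: t] \in F]].

Definition common_tails n (F : {set n.+1.-tuple A}) (a b : A) : {set n.-tuple A} :=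
  [set t : n.-tuple A | ([tuple of a :: t] \in F) && ([tuple of b :: t] \in F)].

(** Each tail gets one distinguished head, given by [c]. Words with the distinguished head inject
    into [tails F]; the tail of any other word is common to two distinct heads, the distinguished
    one and its own, and [phi] records this triple. *)
Lemma card_le_tails n (F : {set n.+1.-tuple A}) :
  (#|F| <= #|tails F| + \sum_(p : A * A | p.1 != p.2) #|common_tails F p.1 p.2|)%N.
Proof.
pose c (t : n.-tuple A) : A := odflt x0 [pick a | [tuple of a :: t] \in F].
have eta (t : n.+1.-tuple A) : [tuple of thead t :: behead_tuple t] = t.
  by rewrite [RHS]tuple_eta; apply/val_inj.
have cF (t : n.+1.-tuple A) : t \in F ->
    [tuple of c (behead_tuple t) :: behead_tuple t] \in F.
  move=> tF; rewrite /c; case: pickP => //= /(_ (thead t)).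
  by rewrite eta tF.
rewrite -(cardsID [set t : n.+1.-tuple A | thead t == c (behead_tuple t)] F) leq_add//.
  rewrite -(card_in_imset (f := fun t : n.+1.-tuple A => behead_tuple t : n.-tuple A))
    => [|t t']; last first.
    rewrite !inE => /andP[_ /eqP e] /andP[_ /eqP e'] tt'.
    by rewrite -(eta t) -(eta t') e e' tt'.
  apply/subset_leq_card/fintype.subsetP => _ /imsetP[t + ->].
  rewrite !inE => /andP[tF _]; apply/existsP; exists (thead t).
  by rewrite eta.
pose phi (t : n.+1.-tuple A) : (A * A) * n.-tuple A :=
  ((c (behead_tuple t), thead t), behead_tuple t).
rewrite -(card_imset (f := phi)); last first.
  move=> t t' e; rewrite -(eta t) -(eta t').
  by rewrite -[thead t]/((phi t).1.2) -[behead_tuple t]/((phi t).2) e.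
rewrite -[leqRHS](_ : #|[set u : (A * A) * n.-tuple A |
    (u.1.1 != u.1.2) && (u.2 \in common_tails F u.1.1 u.1.2)]| = _)%N.
  apply/subset_leq_card/fintype.subsetP => _ /imsetP[t + ->].
  by rewrite !inE /phi /= eta eq_sym => /andP[-> tF]; rewrite tF cF.
rewrite -sum1_card.
under [RHS]eq_bigr do rewrite -sum1_card.
by rewrite pair_big_dep/=; apply: eq_bigl => u; rewrite inE.
Qed.

(** Induction on [n]. Either [tails F] shatters [d.+1] coordinates and heads are put back; or some
    [common_tails F a b] with [a != b] shatters [d] coordinates and the head is one more free
    coordinate; or, with P = #|A| ^ 2, [card_le_tails] bounds #|F| by (1 + n P) ^ d (1 + (n + 1) P),
    against the hypothesis. *)
Lemma natarajan n d (F : {set n.-tuple A}) :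
  ((1 + n * #|A| ^ 2) ^ d < #|F|)%N -> shatters d F.
Proof.
elim: n d F => [|n IHn] [|d] F cardF.
- have /card_gt0P[t tF] : (0 < #|F|)%N by lia.
  by exists id, (fun _ _ => x0), (fun=> t).
- have := max_card F; rewrite card_tuple; move: cardF; rewrite mul0n addn0 exp1n; lia.
- have /card_gt0P[t tF] : (0 < #|F|)%N by lia.
  by exists id, (fun _ _ => x0), (fun=> t).
have [/IHn [idx [g [h [hF hP]]]]|small_tails] :=
    ltnP ((1 + n * #|A| ^ 2) ^ d.+1) #|tails F|.
  have ext t : {a | t \in tails F -> [tuple of a :: t] \in F}.
    case: (pickP (fun a => [tuple of a :: t] \in F)) => [a aF|none]; first by exists a.
    by exists x0; rewrite inE => /existsP[a]; rewrite none.
  exists (succn \o idx), g, (fun s => [tuple of projT1 (ext (h s)) :: h s]); split.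
    by move=> s; apply: (projT2 (ext (h s))).
  by move=> j /hP[? ? ?]; split.
case: (pickP (fun p : A * A =>
    (p.1 != p.2) && ((1 + n * #|A| ^ 2) ^ d < #|common_tails F p.1 p.2|)%N)).
  move=> [a b] /= /andP[ab /IHn [idx [g [h [hF hP]]]]].
  exists (fun j => if j is j'.+1 then (idx j').+1 else 0),
    (fun c j => if j is j'.+1 then g c j' else if c then b else a),
    (fun s => [tuple of (if s 0 then b else a) :: h (s \o succn)]); split.
    by move=> s; have := hF (s \o succn); rewrite inE => /andP[]; case: (s 0).
  by case=> [|j] // /hP[? ? hj]; split => // s; rewrite -(hj (s \o succn)).
move=> small; have := card_le_tails F.
suff : (\sum_(p : A * A | p.1 != p.2) #|common_tails F p.1 p.2| <=
    #|A| ^ 2 * (1 + n * #|A| ^ 2) ^ d)%N.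
  have : ((1 + n * #|A| ^ 2) ^ d <= (1 + n.+1 * #|A| ^ 2) ^ d)%N.
    by case: (d) => [|d'] //; rewrite leq_exp2r//; nia.
  move: small_tails cardF; rewrite ![(_ ^ d.+1)%N]expnS.
  move: ((1 + n * #|A| ^ 2) ^ d)%N ((1 + n.+1 * #|A| ^ 2) ^ d)%N (#|A| ^ 2)%N => u v P.
  by rewrite mulSn; nia.
rewrite -mulnn -[X in (X * _)%N]card_prod -sum_nat_const big_mkcond /=.
apply: leq_sum => p _; have := small p.
by case: ifP => //= _ /negbT; rewrite -leqNgt.
Qed.
End Shattering.

Local Open Scope ring_scope.

(** * The Rademacher projection *)

Section Walsh.
Variables (R : realType) (d : nat).
Local Notation cube := {ffun 'I_d -> bool}.

Definition walsh (A : {set 'I_d}) (s : cube) : R := \prod_(i in A) (-1) ^+ s i.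

Definition walsh_coef (V : lmodType R) (f : cube -> V) (A : {set 'I_d}) : V :=
  2 ^- d *: \sum_s walsh A s *: f s.

(** The powers of [rho] give the noise operator, the indicator of k = 1 the Rademacher
    projection. *)
Definition multiplier (V : lmodType R) (M : nat -> R) (f : cube -> V) (s : cube) : V :=
  \sum_(A : {set 'I_d}) (M #|A| * walsh A s) *: walsh_coef f A.

Lemma walsh_kernel (rho : R) (s r : cube) :
  \sum_(A : {set 'I_d}) rho ^+ #|A| * walsh A s * walsh A r =
  \prod_i (1 + rho * (-1) ^+ s i * (-1) ^+ r i).
Proof.
under [RHS]eq_bigr do rewrite addrC.
rewrite bigA_distr; apply: eq_bigr => A _.
rewrite /walsh -prodr_const -!big_split/= [LHS]big_mkcond /=.
by apply: eq_bigr => i _; case: ifP.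
Qed.

Lemma sum_cube_prod (F : 'I_d -> bool -> R) :
  \sum_(s : cube) \prod_i F i (s i) = \prod_i (F i true + F i false).
Proof.
rewrite -bigA_distr_bigA; apply: eq_bigr => i _.
by rewrite big_bool.
Qed.

Lemma sum_walsh_kernel (rho : R) (s : cube) :
  \sum_(r : cube) \prod_i (1 + rho * (-1) ^+ s i * (-1) ^+ r i) = 2 ^+ d.
Proof.
rewrite (sum_cube_prod (fun i b => 1 + rho * (-1) ^+ s i * (-1) ^+ b)).
rewrite -[in RHS](card_ord d) -prodr_const; apply: eq_bigr => i _ /=.
by rewrite expr0 expr1; ring.
Qed.

Lemma walsh_orthogonal (A B : {set 'I_d}) :
  \sum_(s : cube) walsh A s * walsh B s = if A == B then 2 ^+ d else 0.
Proof.
pose F (i : 'I_d) (b : bool) : R :=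
  (if i \in A then (-1) ^+ b else 1) * (if i \in B then (-1) ^+ b else 1).
rewrite (eq_bigr (fun s : cube => \prod_i F i (s i))); last first.
  move=> s _; rewrite big_split; congr (_ * _); exact: big_mkcond.
rewrite sum_cube_prod; case: eqP => AB.
  rewrite -[in RHS](card_ord d) -prodr_const; apply: eq_bigr => i _ /=.
  by rewrite /F -AB; case: ifP => _; rewrite ?expr0 ?expr1; ring.
have [i] : exists i, (i \in A) != (i \in B).
  by apply/existsP; apply: contra_notT AB => /existsPn h; apply/setP => i; apply/eqP/negPn/h.
move=> iAB; rewrite (bigD1 i)//= /F.
move: iAB; case: (i \in A); case: (i \in B) => //= _; rewrite ?expr0 ?expr1; ring.
Qed.

(** The noise operator averages against a Riesz product, which has mean 1 and is nonnegative when
    |rho| <= 1. *)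
Lemma multiplier_pow (V : lmodType R) (rho : R) (f : cube -> V) s :
  multiplier (GRing.exp rho) f s =
  2 ^- d *: \sum_(r : cube) (\prod_i (1 + rho * (-1) ^+ s i * (-1) ^+ r i)) *: f r.
Proof.
under [in RHS]eq_bigr do rewrite -walsh_kernel scaler_suml.
rewrite exchange_big scaler_sumr; apply: eq_bigr => A _.
rewrite /walsh_coef !scaler_sumr; apply: eq_bigr => r _.
by rewrite !scalerA; congr (_ *: _); ring.
Qed.

(** At [rho = 1] the Riesz product has a vanishing factor unless [r = s], where it equals 2 ^ d. *)
Lemma walsh_inversion (V : lmodType R) (f : cube -> V) s :
  multiplier (fun=> 1) f s = f s.
Proof.
have -> : (fun _ : nat => 1) = GRing.exp (1 : R).
  by apply/funext => k; rewrite expr1n.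
rewrite multiplier_pow (bigD1 s)//= [X in _ + X]big1 ?addr0 => [|r rs].
  rewrite (eq_bigr (fun=> 2)) => [|i _].
    by rewrite prodr_const card_ord scalerA mulVf ?scale1r// expf_neq0.
  by rewrite mul1r; case: (s i); rewrite ?expr0 ?expr1; ring.
have [i ri] : exists i, r i != s i.
  by apply/existsP; apply: contraNT rs => /existsPn h; apply/eqP/ffunP => i; apply/eqP/negPn/h.
rewrite (bigD1 i)//= [X in X * _](_ : _ = 0) ?mul0r ?scale0r// mul1r.
by move: ri; case: (r i); case: (s i) => //= _; rewrite ?expr0 ?expr1; ring.
Qed.

Lemma sum_sqr_walsh (c : {set 'I_d} -> R) :
  \sum_(s : cube) (\sum_A c A * walsh A s) ^+ 2 = 2 ^+ d * \sum_A c A ^+ 2.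
Proof.
under eq_bigr do rewrite expr2 big_distrlr/=.
rewrite exchange_big mulr_sumr; apply: eq_bigr => A _ /=.
rewrite exchange_big (bigD1 A)//= [X in _ + X]big1 ?addr0 => [|B BA].
  under eq_bigr do rewrite mulrACA.
  by rewrite -mulr_sumr walsh_orthogonal eqxx; ring.
under eq_bigr do rewrite mulrACA.
by rewrite -mulr_sumr walsh_orthogonal eq_sym (negPf BA) mulr0.
Qed.

(** Parseval's identity on both sides. It concerns scalar functions, so vector-valued ones are later
    treated coordinate by coordinate. *)
Lemma sum_sqr_multiplier (M : nat -> R) (eta : R) (g : cube -> R^o) :
  (forall k, `|M k| <= eta) ->
  \sum_s multiplier M g s ^+ 2 <= eta ^+ 2 * \sum_s g s ^+ 2.
Proof.
move=> Meta.
have E (N : nat -> R) : \sum_s multiplier N g s ^+ 2 =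
    2 ^+ d * \sum_(A : {set 'I_d}) (N #|A| * walsh_coef g A) ^+ 2.
  rewrite -(sum_sqr_walsh (fun A : {set 'I_d} => N #|A| * walsh_coef g A)).
  by apply: eq_bigr => s _; congr (_ ^+ 2); apply: eq_bigr => A _; rewrite /GRing.scale/=; ring.
have -> : \sum_s g s ^+ 2 = \sum_s multiplier (fun=> 1) g s ^+ 2.
  by apply: eq_bigr => s _; rewrite walsh_inversion.
rewrite !E mulrCA ler_wpM2l ?exprn_ge0// mulr_sumr ler_sum// => A _.
rewrite mul1r exprMn ler_wpM2r ?sqr_ge0//.
by rewrite -[leLHS]real_normK ?num_real// lerXn2r ?nnegrE// (le_trans _ (Meta 0)).
Qed.

Lemma multiplier_rademacher (V : lmodType R) (f : cube -> V) s :
  multiplier (fun k => (k == 1%N)%:R) f s =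
  \sum_(j < d) (-1) ^+ s j *: walsh_coef f [set j].
Proof.
rewrite /multiplier (bigID (fun A => A \in [set [set j] | j : 'I_d]))/=.
rewrite [X in _ + X]big1 ?addr0 => [|A notA]; last first.
  case: eqP => [/eqP/cards1P[j Aj]|_]; last by rewrite mul0r scale0r.
  by rewrite Aj imset_f in notA.
rewrite big_imset => [|i j _ _]/=; last exact: set1_inj.
by apply: eq_bigr => j _; rewrite cards1 /walsh big_set1 mul1r.
Qed.

End Walsh.

(** * Linear combinations of noise operators *)

Lemma multiplier_measure (R : realType) (d : nat) (V : normedModType R)
    (f : {ffun 'I_d -> bool} -> V) (C : R) (mu : seq (R * R)) s :
  (forall s, `|f s| <= C) -> (forall p, p \in mu -> `|p.2| <= 1) ->
  `|multiplier (fun k => \sum_(p <- mu) p.1 * p.2 ^+ k) f s| <= \sum_(p <- mu) `|p.1| * C.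
Proof.
move=> fC mu1.
rewrite (_ : multiplier _ f s = \sum_(p <- mu) p.1 *: multiplier (GRing.exp p.2) f s).
  apply: le_trans (ler_norm_sum _ _ _) _.
  rewrite big_seq [leRHS]big_seq ler_sum// => p /mu1 p1.
  (* Each noise operator is a contraction for the sup norm: its kernel is nonnegative with mean
     1. *)
  rewrite normrZ ler_wpM2l// multiplier_pow normrZ ger0_norm ?invr_ge0 ?exprn_ge0//.
  rewrite -ler_pdivlMl ?invr_gt0 ?exprn_gt0// invrK -(sum_walsh_kernel p.2 s).
  rewrite mulr_suml; apply: le_trans (ler_norm_sum _ _ _) _; apply: ler_sum => r _.
  rewrite normrZ ger0_norm ?ler_wpM2l//; last first.
    apply: prodr_ge0 => i _.
    by move: p1; rewrite ler_norml; case: (s i); case: (r i) => /=; rewrite ?expr0 ?expr1; lra.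
  apply: prodr_ge0 => i _.
  by move: p1; rewrite ler_norml; case: (s i); case: (r i) => /=; rewrite ?expr0 ?expr1; lra.
rewrite /multiplier.
under [RHS]eq_bigr do rewrite scaler_sumr.
rewrite [RHS]exchange_big; apply: eq_bigr => A _ /=.
rewrite mulr_suml scaler_suml; apply: eq_bigr => p _.
by rewrite scalerA; congr (_ *: _); ring.
Qed.

(** A list of pairs encodes the atomic signed measure with mass [p.1] at the point [p.2]. *)
Definition moment (R : realType) (mu : seq (R * R)) (k : nat) : R :=
  \sum_(p <- mu) p.1 * p.2 ^+ k.

(** Contracting the points by [h] multiplies the k-th moment by h ^ k. Subtracting [a] times the
    original measure and dividing by [b] multiplies the moments, as a polynomial in x = h ^ k, by (x
    - a) / b. *)
Lemma measure_factor (R : realType) (h a b : R) (mu : seq (R * R)) :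
  0 <= h <= 1 -> 0 <= a -> 0 < b ->
  (forall p, p \in mu -> `|p.2| <= 1) ->
  exists nu : seq (R * R),
    [/\ forall p, p \in nu -> `|p.2| <= 1,
        \sum_(p <- nu) `|p.1| = (1 + a) / b * \sum_(p <- mu) `|p.1| &
        forall k, moment nu k = (h ^+ k - a) / b * moment mu k].
Proof.
move=> /andP[h0 h1] a0 b0 mu1.
exists ([seq (p.1 / b, p.2 * h) | p <- mu] ++ [seq (- (a / b) * p.1, p.2) | p <- mu]).
split=> [p||k].
- rewrite mem_cat => /orP[] /mapP[q /mu1 q1 ->]//=.
  by rewrite normrM (ger0_norm h0) mulr_ile1.
- rewrite big_cat !big_map/= mulrDl mul1r mulrDl mulr_sumr mulr_sumr; congr (_ + _).
    by apply: eq_bigr => p _; rewrite normrM [`|b^-1|]gtr0_norm ?invr_gt0// mulrC.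
  apply: eq_bigr => p _; rewrite normrM normrN [`|a / b|]ger0_norm//.
  by rewrite divr_ge0// ltW.
- rewrite /moment big_cat !big_map/= mulr_sumr -big_split/=; apply: eq_bigr => p _.
  by rewrite exprMn; ring.
Qed.

(* The moments are those of [\prod_(j in {0, 2, .., N + 1}) (x - h ^ j) / (h - h ^ j)]
   evaluated at [x = h ^ k]. *)
Lemma rademacher_measure (R : realType) (h : R) (N : nat) :
  0 < h -> h <= 2^-1 ->
  exists mu : seq (R * R),
    [/\ forall p, p \in mu -> `|p.2| <= 1,
        \sum_(p <- mu) `|p.1| <= 4 ^+ N.+1 * h ^- N,
        moment mu 1 = 1 &
        forall k, k != 1%N -> `|moment mu k| <= 2 ^+ N.+1 * h ^+ 'C(N.+1, 2)].
Proof.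
move=> h0 h12.
have hpow i j : (i <= j)%N -> h ^+ j <= h ^+ i.
  by move=> ij; apply: ler_wiXn2l => //; lra.
have hle1 i : h ^+ i <= 1 by rewrite -(expr0 h) hpow.
have hge0 i : 0 <= h ^+ i by rewrite exprn_ge0 ?ltW.
suff [mu [mu1 muc m1 m0 mk]] : exists mu : seq (R * R),
    [/\ forall p, p \in mu -> `|p.2| <= 1,
        \sum_(p <- mu) `|p.1| <= 4 ^+ N.+1 * h ^- N,
        moment mu 1 = 1,
        forall k, k != 1%N -> (k < N.+2)%N -> moment mu k = 0 &
        forall k, (N.+2 <= k)%N -> `|moment mu k| <= 2 ^+ N.+1 * h ^+ 'C(N.+1, 2)].
  exists mu; split=> // k k1; have [kN|kN] := ltnP k N.+2; last exact: mk.
  by rewrite m0// normr0 mulr_ge0 ?hge0 ?exprn_ge0.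
elim: N => [|N [mu [mu1 muc m1 m0 mk]]].
  (* This is the factor j = 0 alone: the moments are (1 - h ^ k) / (1 - h). *)
  exists [:: (- (1 - h)^-1, h); ((1 - h)^-1, 1)].
  have h1 : 0 < (1 - h)^-1 by rewrite invr_gt0; lra.
  have h2 : (1 - h)^-1 <= 2 by rewrite invf_ple ?posrE; lra.
  have mE k : moment [:: (- (1 - h)^-1, h); ((1 - h)^-1, 1)] k = (1 - h ^+ k) * (1 - h)^-1.
    by rewrite /moment !big_cons big_nil/= expr1n; ring.
  split=> [p||||].
  - rewrite !inE => /orP[] /eqP -> /=; last by rewrite normr1.
    by rewrite ger0_norm; lra.
  - by rewrite !big_cons big_nil/= normrN gtr0_norm// expr0 expr1; lra.
  - by rewrite mE expr1 mulfV//; lra.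
  - by case=> [|[]]// _ _; rewrite mE expr0 subrr mul0r.
  - move=> k _; rewrite mE bin_small// expr0 mulr1 expr1.
    have := hle1 k; have := hge0 k => ? ?.
    rewrite ger0_norm; last by rewrite mulr_ge0//; lra.
    by rewrite (le_trans _ h2)// ler_piMl; lra.
(* The new factor (x - h ^ (N + 2)) / b fixes the first moment and kills moment N + 2. As b >= h /
   2, it costs at most 4 / h in mass and multiplies later moments by at most 2 h ^ (N + 1). *)
pose b := h - h ^+ N.+2.
have b2 : h / 2 <= b.
  rewrite /b; have := hpow 2%N N.+2 isT.
  have : h ^+ 2 <= h * 2^-1 by rewrite expr2 ler_wpM2l// ltW.
  lra.
have b0 : 0 < b by lra.
have bV : b^-1 <= 2 / h by rewrite -invf_div lef_pV2// posrE; lra.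
have h01 : 0 <= h <= 1 by lra.
have [nu [nu1 nuc num]] := measure_factor h01 (hge0 N.+2) b0 mu1.
exists nu; split=> //.
- rewrite nuc [4 ^+ N.+2]exprSr [h ^+ N.+1]exprS invfM.
  have -> : 4 ^+ N.+1 * 4 * (h^-1 * h ^- N) = 4 / h * (4 ^+ N.+1 * h ^- N) by ring.
  rewrite ler_pM ?sumr_ge0//; first by rewrite divr_ge0 ?(ltW b0)// addr_ge0 ?hge0.
  have -> : 4 / h = 2 * (2 / h) by ring.
  rewrite ler_pM//; [by rewrite addr_ge0 ?hge0|by rewrite invr_ge0 ltW|].
  by have := hle1 N.+2; lra.
- by rewrite num m1 expr1 mulr1 mulfV// gt_eqF.
- move=> k k1; rewrite num ltnS leq_eqVlt => /orP[/eqP->|kN]; last by rewrite m0// mulr0.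
  by rewrite subrr !mul0r.
- move=> k kN; rewrite num normrM mulrC.
  have -> : 2 ^+ N.+2 * h ^+ 'C(N.+2, 2) =
      (2 ^+ N.+1 * h ^+ 'C(N.+1, 2)) * (h ^+ N.+2 * (2 / h)) :> R.
    rewrite binS bin1 exprD (exprSr _ N.+1) (exprSr h N.+1).
    by field; rewrite gt_eqF.
  rewrite ler_pM//; first by apply: mk; exact: leq_trans (ltnW _) kN.
  rewrite normrM [`|b^-1|]gtr0_norm ?invr_gt0//.
  rewrite ler_pM ?invr_ge0 ?(ltW b0)//.
  have := hpow _ _ (ltnW kN); have := hge0 k; have := hge0 N.+2 => ? ? ?.
  by rewrite ler0_norm; lra.
Qed.

(** * Estimate of the Rademacher projection *)

Lemma sqr_sum_le (R : realDomainType) (I : finType) (a : I -> R) :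
  (\sum_i a i) ^+ 2 <= #|I|%:R * \sum_i a i ^+ 2.
Proof.
rewrite expr2 big_distrlr/= -(ler_pM2r (ltr0n R 2)).
rewrite [leRHS](_ : _ = \sum_i \sum_j (a i ^+ 2 + a j ^+ 2)); last first.
  under [RHS]eq_bigr do rewrite big_split/= sumr_const -mulr_natl.
  by rewrite big_split/= -mulr_sumr sumr_const -mulr_natl; ring.
rewrite mulr_suml ler_sum// => i _; rewrite mulr_suml ler_sum// => j _.
by have := sqr_ge0 (a i - a j); nra.
Qed.

Lemma le_sqrD (R : realDomainType) (p q r v w : R) :
  r <= (p + q) ^+ 2 -> p ^+ 2 <= w -> q ^+ 2 <= v -> r <= 2 * w + 2 * v.
Proof. by have := sqr_ge0 (p - q); nra. Qed.

Lemma multiplierB (R : realType) d (V : lmodType R) (M M' : nat -> R)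
    (f : {ffun 'I_d -> bool} -> V) s :
  multiplier (fun k => M k - M' k) f s = multiplier M f s - multiplier M' f s.
Proof.
by rewrite /multiplier -sumrB; apply: eq_bigr => A _; rewrite mulrBl scalerBl.
Qed.

Lemma walsh_coef_sum (R : realType) d (V : lmodType R) n
    (z : 'I_n -> {ffun 'I_d -> bool} -> R^o) (u : 'I_n -> V) S :
  walsh_coef (fun s => \sum_i z i s *: u i) S = \sum_i walsh_coef (z i) S *: u i.
Proof.
rewrite /walsh_coef; under [in LHS]eq_bigr do rewrite scaler_sumr.
rewrite exchange_big !scaler_sumr; apply: eq_bigr => i _ /=.
rewrite [X in _ *: X](_ : _ = (\sum_s0 walsh R S s0 * z i s0) *: u i).
  by rewrite !scalerA.
by rewrite scaler_suml; apply: eq_bigr => s0 _; rewrite scalerA.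
Qed.

Lemma multiplier_sum (R : realType) d (V : lmodType R) (M : nat -> R) n
    (z : 'I_n -> {ffun 'I_d -> bool} -> R^o) (u : 'I_n -> V) s :
  multiplier M (fun s => \sum_i z i s *: u i) s = \sum_i multiplier M (z i) s *: u i.
Proof.
rewrite /multiplier; under eq_bigr do rewrite walsh_coef_sum scaler_sumr.
rewrite exchange_big; apply: eq_bigr => i _ /=.
by rewrite scaler_suml; apply: eq_bigr => A _; rewrite scalerA.
Qed.

(** The projection is the multiplier by the moments minus the multiplier by [M], the moments with
    the first one removed. The former is bounded uniformly by the mass of [mu]; the latter
    coordinatewise in L2, where Cauchy-Schwarz and the sum over coordinates each cost a factor
    [n]. *)
Lemma rademacher_projection_bound (R : realType) d (X : normedModType R) n
    (u : 'I_n -> X) (z : 'I_n -> {ffun 'I_d -> bool} -> R^o) (mu : seq (R * R))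
    (b C eta L : R) (f := fun s => \sum_i z i s *: u i) :
  0 <= eta ->
  (forall i, `|u i| <= b) -> (forall i s, `|z i s| <= L) ->
  (forall s, `|f s| <= C) -> (forall p, p \in mu -> `|p.2| <= 1) ->
  moment mu 1 = 1 -> (forall k, k != 1%N -> `|moment mu k| <= eta) ->
  2 ^- d * \sum_(s : {ffun 'I_d -> bool})
     `|\sum_(j < d) (-1) ^+ s j *: walsh_coef f [set j]| ^+ 2 <=
  2 * (\sum_(p <- mu) `|p.1| * C) ^+ 2 + 2 * (b * n%:R * eta * L) ^+ 2.
Proof.
move=> eta0 ub zL fC mu1 m1 mk.
pose M k := if k == 1%N then 0 else moment mu k.
have radE (s : {ffun 'I_d -> bool}) : \sum_(j < d) (-1) ^+ s j *: walsh_coef f [set j] =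
    multiplier (moment mu) f s - multiplier M f s.
  rewrite -multiplierB -multiplier_rademacher; congr (multiplier _ f s).
  by apply/funext => k; rewrite /M; case: eqP => [->|_]; rewrite ?m1 ?subr0 ?subrr.
have Meta k : `|M k| <= eta.
  by rewrite /M; case: eqP => [_|/eqP]; [rewrite normr0|exact: mk].
have b0 (i : 'I_n) : 0 <= b by exact: le_trans (normr_ge0 _) (ub i).
have MfE s : `|multiplier M f s| <= b * \sum_i `|multiplier M (z i) s|.
  rewrite multiplier_sum mulr_sumr; apply: le_trans (ler_norm_sum _ _ _) _.
  by apply: ler_sum => i _; rewrite normrZ mulrC ler_wpM2r.
have Mf2 s : `|multiplier M f s| ^+ 2 <= b ^+ 2 * (n%:R * \sum_i multiplier M (z i) s ^+ 2).
  apply: (@le_trans _ _ ((b * \sum_i `|multiplier M (z i) s|) ^+ 2)).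
    by rewrite lerXn2r// nnegrE// (le_trans _ (MfE s)).
  rewrite exprMn ler_wpM2l ?sqr_ge0// (le_trans (sqr_sum_le _))// card_ord.
  by under eq_bigr do rewrite real_normK ?num_real//.
have z2 i : \sum_s multiplier M (z i) s ^+ 2 <= 2 ^+ d * (eta * L) ^+ 2.
  apply: le_trans (sum_sqr_multiplier _ Meta) _.
  rewrite exprMn [leRHS]mulrCA ler_wpM2l ?sqr_ge0//.
  apply: le_trans (ler_sum _ (_ : forall s, true -> z i s ^+ 2 <= L ^+ 2)) _.
    by move=> s _; rewrite -[leLHS]real_normK ?num_real// lerXn2r// nnegrE// (le_trans _ (zL i s)).
  by rewrite sumr_const card_ffun card_bool card_ord -(mulr_natl _ (2 ^ d)) natrX.
rewrite ler_pdivrMl ?exprn_gt0//.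
apply: (@le_trans _ _ (\sum_(s : {ffun 'I_d -> bool})
  (2 * (\sum_(p <- mu) `|p.1| * C) ^+ 2 +
   2 * (b ^+ 2 * (n%:R * \sum_i multiplier M (z i) s ^+ 2))))).
  apply: ler_sum => s _; rewrite radE.
  set P := multiplier (moment mu) f s; set Q := multiplier M f s.
  have hP : `|P| ^+ 2 <= (\sum_(p <- mu) `|p.1| * C) ^+ 2.
    have hP : `|P| <= \sum_(p <- mu) `|p.1| * C by exact: multiplier_measure.
    by rewrite lerXn2r// nnegrE// (le_trans _ hP).
  have hPQ : `|P - Q| ^+ 2 <= (`|P| + `|Q|) ^+ 2.
    by rewrite lerXn2r ?nnegrE ?addr_ge0 ?ler_normB//.
  exact: le_sqrD hPQ hP (Mf2 s).
rewrite big_split/= sumr_const card_ffun card_bool card_ord -(mulr_natl _ (2 ^ d)) natrX.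
rewrite [leRHS]mulrDr lerD2l -!mulr_sumr exchange_big/=.
apply: (@le_trans _ _ (2 * (b ^+ 2 * (n%:R * (n%:R * (2 ^+ d * (eta * L) ^+ 2)))))).
  rewrite ler_wpM2l// ler_wpM2l ?sqr_ge0// ler_wpM2l//.
  apply: le_trans (ler_sum _ (fun i _ => z2 i)) _.
  by rewrite sumr_const card_ord -[leLHS]mulr_natl.
by rewrite le_eqVlt; apply/orP; left; apply/eqP; ring.
Qed.

(** * Cotype against the half-integer net *)

Lemma exists_nat_gt (R : realType) (x : R) : exists N : nat, x < N%:R.
Proof.
by exists (Num.bound `|x|); apply: le_lt_trans (ler_norm x) _; rewrite archi_boundP.
Qed.

(** Compare both sides with d ^ 3; the induction starts at 1000 < 1024. *)
Lemma cubic_lt_exp2 d P : (10 <= d)%N -> (P < d)%N -> (1 + d ^ 2 * P < 2 ^ d)%N.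
Proof.
move=> d10 Pd; apply: (@leq_ltn_trans (d ^ 3)); first by rewrite !expnS expn0; nia.
elim: d d10 {Pd} => // d IHd; rewrite leq_eqVlt => /orP[/eqP <-//|d10].
have := IHd d10; rewrite [(2 ^ _.+1)%N]expnS !(expnS _ 2) !expnS !expn0; nia.
Qed.

(** A function of one sign is a constant plus a multiple of [walsh R [set j]]; orthogonality
    extracts the multiple. *)
Lemma walsh_coef_coordinate (R : realType) d (g : bool -> R) (j : 'I_d) :
  walsh_coef (fun s : {ffun 'I_d -> bool} => g (s j) : R^o) [set j] =
  (g false - g true) / 2.
Proof.
pose u : R := (g false - g true) / 2.
pose v : R := (g false + g true) / 2.
rewrite /walsh_coef (eq_bigr (fun s : {ffun 'I_d -> bool} =>
  u * (walsh R [set j] s * walsh R [set j] s) + v * (walsh R finset.set0 s * walsh R [set j] s))).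
  rewrite big_split/= -!mulr_sumr !walsh_orthogonal eqxx.
  rewrite eq_sym -cards_eq0 cards1/= mulr0 addr0 /GRing.scale/=.
  by rewrite mulrCA mulVf ?mulr1// expf_neq0.
move=> s _; rewrite /walsh big_set0 big_set1 /GRing.scale/= /u /v.
by case: (s j); rewrite ?expr0 ?expr1; field.
Qed.

Section HalfLattice.
Variables (R : realType) (X : normedModType R) (e : nat -> X) (b kappa C : R).
Hypotheses (e_le : forall i, `|e i| <= b)
  (coord_le : forall n (a : nat -> R) i, (i < n)%N ->
     `|a i| <= kappa * `|\sum_(i < n) a i *: e i|)
  (half_net : forall n (s : nat -> bool), exists z : nat -> int,
     (forall i, odd `|z i|%N = s i) /\ `|\sum_(i < n) (z i)%:~R *: e i| <= C).

Lemma kappa_gt0 : 0 < kappa.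
Proof.
have := @coord_le 1 (fun=> 1) 0 isT; rewrite normr1 => h.
rewrite ltNge; apply/negP => k0; move: h; apply/negP; rewrite -ltNge.
by rewrite (le_lt_trans _ ltr01)// mulr_le0_ge0.
Qed.

(* Parity separates the words obtained from distinct patterns, so [natarajan] applies
   to 2 ^ (d ^ 2) words over an alphabet of size 2 N + 1. *)
Lemma half_net_shattering (N d : nat) : kappa * C <= N%:R ->
  (1 + d ^ 2 * N.*2.+1 ^ 2 < 2 ^ d)%N ->
  exists (z : 'I_(d ^ 2) -> {ffun 'I_d -> bool} -> R^o)
    (idx : 'I_d -> 'I_(d ^ 2)) (g : 'I_d -> bool -> R),
    [/\ forall i s, `|z i s| <= N%:R,
        forall s, `|\sum_i z i s *: e i| <= C,
        forall j s, z (idx j) s = g j (s j) &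
        forall j, 1 <= `|g j false - g j true|].
Proof.
move=> kC dlarge; set n := (d ^ 2)%N.
have /choice[zf zfP] : forall s : {ffun 'I_n -> bool}, exists z : nat -> int,
    (forall i : 'I_n, odd `|z i|%N = s i) /\ `|\sum_(i < n) (z i)%:~R *: e i| <= C.
  move=> s; have [z [zs zC]] := half_net n (fun i => oapp s false (insub i)).
  by exists z; split=> // i; rewrite zs valK.
have zfN s (i : 'I_n) : `|zf s i| <= N%:Z.
  rewrite -(ler_int R) intr_norm.
  have := coord_le (fun i => (zf s i)%:~R) (ltn_ord i).
  move=> /le_trans -> //; apply: le_trans kC.
  by rewrite ler_pM2l ?kappa_gt0//; case: (zfP s).
(* Entries lie in [-N, N]; the shift by [N] turns them into letters of an alphabet of size 2 N +
   1. *)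
pose t (s : {ffun 'I_n -> bool}) : n.-tuple 'I_N.*2.+1 :=
  [tuple inord (`|(zf s i + N%:Z)%R|%N) | i < n].
have tE s (i : 'I_n) : (nth ord0 (t s) i : nat)%:Z = zf s i + N%:Z.
  rewrite -tnth_nth tnth_mktuple inordK; have := zfN s i; rewrite ler_norml; lia.
have t_inj : injective t.
  move=> s s' tt'; apply/ffunP => i; have [<- _] := zfP s; have [<- _] := zfP s'.
  congr (odd `|_|%N); apply: (addIr N%:Z); by rewrite -!tE tt'.
(* Both sides are [d]-th powers, as 2 ^ (d ^ 2) = (2 ^ d) ^ d; [dlarge] excludes d = 0. *)
have : ((1 + n * #|'I_N.*2.+1| ^ 2) ^ d < #|[set t s | s in [set: {ffun 'I_n -> bool}]]|)%N.
  rewrite card_imset// cardsT card_ffun card_bool !card_ord /n.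
  rewrite -[X in (_ < 2 ^ X)%N]mulnn expnM.
  case: d @n dlarge {zf zfP zfN t tE t_inj} => // d' n dlarge.
  by rewrite ltn_exp2r.
move=> /(natarajan ord0) [idx [g [h [hF hP]]]].
pose ext (s : {ffun 'I_d -> bool}) (j : nat) : bool := oapp s false (insub j).
pose z (i : 'I_n) (s : {ffun 'I_d -> bool}) : R^o :=
  (nth ord0 (h (ext s)) i : nat)%:R - N%:R.
have zE s : exists s', forall i, z i s = (zf s' i)%:~R.
  have /imsetP[s' _ hs'] := hF (ext s); exists s' => i.
  have := congr1 (fun k : int => k%:~R : R) (tE s' i).
  by rewrite /= /z hs' intrD -!pmulrn => ->; rewrite addrK.
exists z, (fun j : 'I_d => Ordinal (let: And3 h _ _ := hP j (ltn_ord j) in h)),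
  (fun j c => (g c j : nat)%:R - N%:R); split.
- move=> i s; have [s' ->] := zE s.
  by rewrite -intr_norm pmulrn ler_int.
- move=> s; have [s' zs'] := zE s; under eq_bigr do rewrite zs'.
  by case: (zfP s').
- move=> j s; rewrite /z /=; case: (hP j (ltn_ord j)) => _ _ /(_ (ext s)) ->.
  by rewrite /ext valK.
- move=> j; case: (hP j (ltn_ord j)) => _ gj _.
  rewrite opprB addrA subrK !pmulrn -intrB -intr_norm -[1]/(1%:~R) ler_int.
  have : (g false j : nat) != g true j by [].
  lia.
Qed.

Variables (q c : R).
Hypotheses (q_gt0 : 0 < q)
  (cotype_c : forall (n : nat) (v : 'I_n -> X),
    (\sum_(i < n) `|v i| `^ q) `^ q^-1 <=
    c * Num.sqrt (2 ^- n * \sum_(s : {ffun 'I_n -> bool})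
                             `|\sum_(i < n) (-1) ^+ s i *: v i| ^+ 2)).

(** At the shattered coordinate [idx j], the Rademacher coefficient [v j] has entry of size at least
    1 / 2, so |v j| >= 1 / (2 kappa) by [coord_le]. Cotype turns this into the left side;
    [rademacher_projection_bound] with the measure of [rademacher_measure] gives the right side. *)
Lemma cotype_half_net (N d D : nat) (h : R) : kappa * C <= N%:R ->
  (1 + d ^ 2 * N.*2.+1 ^ 2 < 2 ^ d)%N -> 0 < h -> h <= 2^-1 ->
  (d%:R `^ q^-1) ^+ 2 * (2 * kappa) ^- 2 <= c ^+ 2 *
    (2 * (4 ^+ D.+1 * h ^- D * C) ^+ 2 +
     2 * (b * (d ^ 2)%:R * (2 ^+ D.+1 * h ^+ 'C(D.+1, 2)) * N%:R) ^+ 2).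
Proof.
move=> kC dlarge h0 h12.
have [z [idx [g [zN zC zg g1]]]] := half_net_shattering kC dlarge.
have [mu [mu1 muc m1 mk]] := rademacher_measure D h0 h12.
have eta0 : 0 <= 2 ^+ D.+1 * h ^+ 'C(D.+1, 2) by rewrite mulr_ge0// exprn_ge0// ltW.
have C0 : 0 <= C by apply: le_trans (zC [ffun=> false]).
pose f (s : {ffun 'I_d -> bool}) : X := \sum_i z i s *: e i.
pose v (j : 'I_d) : X := walsh_coef f [set j].
have upper : 2 ^- d * \sum_(s : {ffun 'I_d -> bool})
    `|\sum_(j < d) (-1) ^+ s j *: v j| ^+ 2 <=
    2 * (4 ^+ D.+1 * h ^- D * C) ^+ 2 +
    2 * (b * (d ^ 2)%:R * (2 ^+ D.+1 * h ^+ 'C(D.+1, 2)) * N%:R) ^+ 2.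
  apply: le_trans (rademacher_projection_bound eta0 (fun i => e_le (nat_of_ord i))
    zN zC mu1 m1 mk) _.
  rewrite -mulr_suml lerD2r ler_wpM2l// lerXn2r ?nnegrE ?mulr_ge0 ?sumr_ge0 ?invr_ge0 ?exprn_ge0//.
    exact: ltW.
  exact: ler_wpM2r.
have vk j : (2 * kappa)^-1 <= `|v j|.
  rewrite invfM ler_pdivrMr ?kappa_gt0// mulrC.
  pose a (i : nat) : R := oapp (fun i => walsh_coef (z i) [set j] : R) 0 (insub i).
  have -> : v j = \sum_(i < d ^ 2) a i *: e i.
    by rewrite /v /f walsh_coef_sum; apply: eq_bigr => i _; rewrite /a valK.
  apply: le_trans (coord_le a (ltn_ord (idx j))).
  rewrite /a valK/= [X in walsh_coef X](_ : _ =
      fun s : {ffun 'I_d -> bool} => g j (s j)); last first.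
    by apply/funext => s; rewrite zg.
  rewrite walsh_coef_coordinate normrM [`|2^-1|]gtr0_norm//.
  by have := g1 j; lra.
have : (d%:R `^ q^-1) * (2 * kappa)^-1 <= (\sum_(i < d) `|v i| `^ q) `^ q^-1.
  have k0 : 0 <= (2 * kappa)^-1 by rewrite invr_ge0 mulr_ge0// ltW// kappa_gt0.
  have -> : d%:R `^ q^-1 * (2 * kappa)^-1 = (\sum_(i < d) (2 * kappa)^-1 `^ q) `^ q^-1.
    rewrite sumr_const card_ord -[X in _ = X `^ _]mulr_natl powRM ?powR_ge0//.
    by rewrite -powRrM mulfV ?gt_eqF// powRr1.
  apply: ge0_ler_powR; rewrite ?invr_ge0 ?(ltW q_gt0) ?nnegrE ?sumr_ge0//;
    try by move=> i _; exact: powR_ge0.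
  by apply: ler_sum => i _; apply: ge0_ler_powR; rewrite ?nnegrE// ltW.
move=> /le_trans/(_ (cotype_c v)) lower.
move: lower upper; set S := 2 ^- d * _ => lower upper.
apply: (@le_trans _ _ (c ^+ 2 * S)); last by rewrite ler_wpM2l ?sqr_ge0.
have lower0 : 0 <= d%:R `^ q^-1 / (2 * kappa).
  by rewrite mulr_ge0 ?powR_ge0// invr_ge0 mulr_ge0// ltW// kappa_gt0.
have S0 : 0 <= S by rewrite mulr_ge0 ?invr_ge0 ?exprn_ge0// sumr_ge0// => s _; exact: sqr_ge0.
rewrite -[(2 * kappa) ^- 2]exprVn -exprMn -[S](sqr_sqrtr S0) -exprMn lerXn2r// nnegrE//.
exact: le_trans lower0 lower.
Qed.

Lemma half_net_cotype_false : False.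
Proof.
have [N kC] := exists_nat_gt (kappa * C).
have [[|Q'] qQ] := exists_nat_gt q; first by rewrite ltNge ltW in qQ.
pose Q := Q'.+1.
(* With U = H ^ D, the lower bound is of order d ^ (1 / q) >= U ^ 2, the noise operators
   cost a factor U, and h ^ 'C(D + 1, 2) = d ^ -2 cancels the error term. *)
pose D := (8 * Q).-1.
pose Gamma := c ^+ 2 * (2 * (4 ^+ D.+1 * C) ^+ 2 + 2 * (b * 2 ^+ D.+1 * N%:R) ^+ 2).
have [K GK] := exists_nat_gt (Gamma * (2 * kappa) ^+ 2).
(* The first two summands give [dlarge] through [cubic_lt_exp2]; [K] makes [U] exceed Gamma (2
   kappa) ^ 2. *)
pose H := (10 + N.*2.+1 ^ 2 + K)%N.
pose d := (H ^ (2 * Q * D))%N; pose h : R := H%:R^-1; pose U : R := H%:R ^+ D.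
have D8 : (8 * Q)%N = D.+1 by rewrite /D prednK// muln_gt0.
have H1 : 1 <= H%:R :> R by rewrite ler1n.
have H0 : H%:R != 0 :> R by rewrite pnatr_eq0.
have Hd : (H <= d)%N.
  by rewrite /d -[X in (X <= _)%N]expn1 leq_exp2l//; rewrite /Q; lia.
have HU : H%:R <= U.
  by rewrite /U -[X in X <= _]expr1 ler_weXn2l//; lia.
have dlarge : (1 + d ^ 2 * N.*2.+1 ^ 2 < 2 ^ d)%N.
  by apply: cubic_lt_exp2; move: Hd; rewrite /H; lia.
have h0 : 0 < h by rewrite invr_gt0 ltr0n.
have h12 : h <= 2^-1 by rewrite lef_pV2 ?posrE ?ltr0n// ler_nat.
have := cotype_half_net D (ltW kC) dlarge h0 h12.
have -> : 4 ^+ D.+1 * h ^- D * C = 4 ^+ D.+1 * C * U.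
  by rewrite /h exprVn invrK mulrAC.
have -> : b * (d ^ 2)%:R * (2 ^+ D.+1 * h ^+ 'C(D.+1, 2)) * N%:R = b * 2 ^+ D.+1 * N%:R.
  have -> : 'C(D.+1, 2) = (2 * Q * D * 2)%N.
    by rewrite bin2 -D8 /=; move: D8; lia.
  rewrite /d -expnM natrX /h exprVn.
  by field; rewrite expf_neq0.
have dq : U ^+ 2 <= d%:R `^ q^-1.
  rewrite /d natrX -[_ ^+ (2 * Q * D)]powR_mulrn ?ler0n// -powRrM /U -exprM.
  rewrite -powR_mulrn ?ler0n//.
  rewrite ler_powR// ler_pdivlMr//.
  have -> : (2 * Q * D)%:R = (D * 2)%:R * Q%:R :> R by rewrite -natrM; congr _%:R; lia.
  by rewrite ler_wpM2l ?ler0n// ltW.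
have k0 := kappa_gt0.
have H2 : Gamma * (2 * kappa) ^+ 2 < U.
  by rewrite (lt_le_trans GK)// (le_trans _ HU)// ler_nat /H leq_addl.
have U1 : 1 <= U by exact: le_trans HU.
move=> key.
(* Cancelling U ^ 2 leaves U ^ 2 <= Gamma (2 kappa) ^ 2 < U, impossible since U >= 1. *)
have : (U ^+ 2) ^+ 2 * (2 * kappa) ^- 2 <= Gamma * U ^+ 2.
  apply: (@le_trans _ _ ((d%:R `^ q^-1) ^+ 2 * (2 * kappa) ^- 2)).
    rewrite ler_wpM2r ?invr_ge0 ?exprn_ge0 ?mulr_ge0 ?(ltW k0)//.
    by rewrite lerXn2r// nnegrE ?powR_ge0// exprn_ge0// (le_trans ler01 U1).
  apply: le_trans key _; rewrite /Gamma -[leRHS]mulrA ler_wpM2l ?sqr_ge0// [leRHS]mulrDl lerD//.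
    by rewrite exprMn mulrA.
  by rewrite ler_peMr ?exprn_ege1// mulr_ge0// sqr_ge0.
rewrite ler_pdivrMr ?exprn_gt0 ?mulr_gt0//.
rewrite [leLHS]expr2 [leRHS]mulrAC ler_pM2r ?exprn_gt0 ?(lt_le_trans _ U1)//.
have UU : U <= U ^+ 2 by rewrite expr2 ler_peMr// (le_trans ler01 U1).
by move=> U2; have := lt_le_trans H2 (le_trans UU U2); rewrite ltxx.
Qed.
End HalfLattice.

Local Open Scope classical_set_scope.

(** * Partial sums of a Schauder basis *)

Lemma half_geometric_small (R : realType) (A eps : R) : 0 < eps ->
  exists k : nat, A / 2 ^+ k < eps.
Proof.
move=> eps0; exists (Num.bound `|A / eps|).
rewrite ltr_pdivrMr ?exprn_gt0// mulrC -ltr_pdivrMr//.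
apply: le_lt_trans (ler_norm _) _.
apply: lt_trans (archi_boundP (normr_ge0 _)) _.
by rewrite -natrX ltr_nat ltn_expl.
Qed.

Section PartialSumBound.
Variables (R : realType) (X : completeNormedModType R) (e : nat -> X).
Hypothesis eb : schauder_basis e.

Definition basis_coef (x : X) : nat -> R := projT1 (cid (eb x)).

Definition partial_sum (n : nat) (x : X) : X :=
  \sum_(0 <= i < n) basis_coef x i *: e i.

Lemma partial_sum_cvg x : partial_sum ^~ x @ \oo --> x.
Proof. by have [] := projT2 (cid (eb x)). Qed.

Lemma basis_coef_unique x (a : nat -> R) :
  series (fun i => a i *: e i) @ \oo --> x -> basis_coef x = a.
Proof. by have [_ h] := projT2 (cid (eb x)); exact: h. Qed.

Lemma basis_coef_linear (k : R) (x y : X) i :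
  basis_coef (k *: x + y) i = k * basis_coef x i + basis_coef y i.
Proof.
suff /basis_coef_unique -> : series (fun i => (k * basis_coef x i + basis_coef y i) *: e i)
  @ \oo --> k *: x + y by [].
rewrite (_ : series _ = fun n => k *: partial_sum n x + partial_sum n y).
  by apply: cvgD; [apply: cvgZr; exact: partial_sum_cvg|exact: partial_sum_cvg].
apply/funext => n; rewrite /series/= /partial_sum scaler_sumr -big_split/=.
by apply: eq_bigr => j _; rewrite scalerDl scalerA.
Qed.

Lemma partial_sum_linear n (k : R) (x y : X) :
  partial_sum n (k *: x + y) = k *: partial_sum n x + partial_sum n y.
Proof.
rewrite /partial_sum scaler_sumr -big_split/=.
by apply: eq_bigr => j _; rewrite basis_coef_linear scalerDl scalerA.
Qed.

Lemma partial_sumB n (x y : X) :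
  partial_sum n (x - y) = partial_sum n x - partial_sum n y.
Proof. by rewrite addrC -scaleN1r partial_sum_linear scaleN1r addrC. Qed.

Lemma partial_sum0 n : partial_sum n 0 = 0.
Proof. by have := partial_sumB n 0 0; rewrite !subrr. Qed.

Lemma partial_sumZ n (k : R) (x : X) : partial_sum n (k *: x) = k *: partial_sum n x.
Proof. by rewrite -[k *: x]addr0 partial_sum_linear partial_sum0 addr0. Qed.

(** A zero basis vector would give 0 several expansions. *)
Lemma basis_neq0 i : e i != 0.
Proof.
apply/eqP => ei0.
have h (c : R) : basis_coef 0 = (fun j => if j == i then c else 0).
  apply: basis_coef_unique; rewrite (_ : series _ = cst 0); first exact: cvg_cst.
  apply/funext => n; rewrite /series/= big1// => j _.
  by case: eqP => [->|]; rewrite ?ei0 ?scaler0 ?scale0r.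
have := h 0; rewrite (h 1) => /(congr1 (@^~ i)); rewrite eqxx => /eqP.
by rewrite oner_eq0.
Qed.

(** The ball of radius [M] for the norm sup_n |partial_sum n x|. *)
Definition sums_bounded (M : R) : set X :=
  [set x | forall n, `|partial_sum n x| <= M].

Lemma sums_boundedW M M' x : M <= M' -> sums_bounded M x -> sums_bounded M' x.
Proof. by move=> MM' Mx n; exact: le_trans (Mx n) MM'. Qed.

Lemma sums_boundedB M x y :
  sums_bounded M x -> sums_bounded M y -> sums_bounded (2 * M) (x - y).
Proof.
move=> Mx My n; rewrite partial_sumB (le_trans (ler_normB _ _))//.
by rewrite mulr2n mulrDl mul1r lerD.
Qed.

Lemma sums_boundedZ M k x :
  sums_bounded M x -> sums_bounded (`|k| * M) (k *: x).
Proof. by move=> Mx n; rewrite partial_sumZ normrZ ler_wpM2l. Qed.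

Lemma sums_bounded_cover x : exists N : nat, sums_bounded N%:R x.
Proof.
have [M [_ hM]] := cvg_seq_bounded (cvgP _ (@partial_sum_cvg x)).
exists (Num.bound `|M + 1|) => n.
apply: (@le_trans _ _ (M + 1)); first by apply: hM => //; rewrite ltrDl.
by rewrite ltW// (le_lt_trans (ler_norm _))// archi_boundP.
Qed.

(** If all the open sets [F i] were dense, Baire's theorem would give a point with unbounded partial
    sums, against [sums_bounded_cover]. *)
Lemma sums_bounded_somewhere_dense : exists (N : nat) (x0 : X) (r : R), 0 < r /\
  forall y, `|x0 - y| < r -> closure (sums_bounded N%:R) y.
Proof.
pose F (i : nat) : set X := ~` closure (sums_bounded i%:R).
have [/= h|] := pselect (forall i, dense (F i)).
  have : dense (\bigcap_i F i).
    by apply: Baire => i; split => //; apply: closed_openC; exact: closed_closure.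
  move=> /(_ setT); rewrite setTI => /(_ _ openT) [|x xF]; first by exists 0.
  by have [N Nx] := sums_bounded_cover x; case: (xF N I); exact: subset_closure.
move=> /existsNP[i] /existsNP[V] /not_implyP[[x0 Vx0]] /not_implyP[Vopen VF].
exists i, x0; have /nbhs_ballP[r /= r0 rV] := open_nbhs_nbhs (conj Vopen Vx0).
exists r; split=> // y xy; apply: contrapT => nAy; apply: VF; exists y; split=> //.
by apply: rV; rewrite -ball_normE.
Qed.

(** As in the open mapping theorem: approximate x0 + lam x and x0 inside the ball where
    [sums_bounded N%:R] is dense, subtract, and divide by lam. *)
Lemma sums_bounded_approx : exists2 C : R, 0 < C &
  forall x eps, 0 < eps -> exists2 u, sums_bounded (C * `|x|) u & `|x - u| < eps.
Proof.
have [N [x0 [r [r0 hN]]]] := sums_bounded_somewhere_dense.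
have near_x0 y eps : 0 < eps -> `|x0 - y| < r ->
    exists2 u, sums_bounded N%:R u & `|y - u| < eps.
  move=> eps0 /hN /(_ (ball y eps) (nbhsx_ballx _ _ eps0))[u [Nu]].
  by rewrite -ball_normE => yu; exists u.
(* The difference has bound 2 N and 1 / lam = 2 |x| / r, whence 4 N / r; the extra 1 keeps the
   constant positive when N = 0. *)
exists ((4 * N%:R + 1) / r); first by rewrite divr_gt0// ltr_wpDl// mulr_ge0.
move=> x eps eps0; have [->|x_neq0] := eqVneq x 0.
  by exists 0; [move=> n; rewrite partial_sum0 !normr0 mulr0|rewrite subr0 normr0].
have nx : 0 < `|x| by rewrite normr_gt0.
pose lam := r / (2 * `|x|); have lam0 : 0 < lam by rewrite divr_gt0// mulr_gt0.
have eps1 : 0 < lam * eps / 2 by rewrite divr_gt0// mulr_gt0.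
have [||u1 Nu1 xu1] := near_x0 (x0 + lam *: x) (lam * eps / 2) => //.
  rewrite opprD addNKr normrN normrZ gtr0_norm// (_ : lam * _ = r / 2);
    last by rewrite /lam; field; rewrite gt_eqF.
  by rewrite ltr_pdivrMr// ltr_pMr// ltr1n.
have [||u2 Nu2 xu2] := near_x0 x0 (lam * eps / 2) => //; first by rewrite subrr normr0.
exists (lam^-1 *: (u1 - u2)).
  apply: sums_boundedW (sums_boundedZ _ (sums_boundedB Nu1 Nu2)).
  rewrite gtr0_norm ?invr_gt0// /lam invf_div.
  rewrite (_ : _ / r * _ = (4 * N%:R) / r * `|x|); last by ring.
  by rewrite ler_wpM2r// ler_wpM2r ?invr_ge0 ?(ltW r0)// lerDl.
have -> : x - lam^-1 *: (u1 - u2) = lam^-1 *: ((x0 + lam *: x - u1) - (x0 - u2)).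
  have {1}-> : x = lam^-1 *: (lam *: x) by rewrite scalerA mulVf ?scale1r// gt_eqF.
  by rewrite -scalerBr !opprB [in RHS]addrC -[x0 + _ - _]addrA addrA subrK addrCA.
rewrite normrZ gtr0_norm ?invr_gt0// ltr_pdivrMl// (le_lt_trans (ler_normB _ _))//.
by move: xu1 xu2; lra.
Qed.

Lemma basis_coef_le x M : sums_bounded M x -> forall i, `|basis_coef x i| * `|e i| <= 2 * M.
Proof.
move=> Mx i; rewrite -normrZ.
have -> : basis_coef x i *: e i = partial_sum i.+1 x - partial_sum i x.
  by rewrite /partial_sum big_nat_recr//= [X in X - _]addrC addrK.
by rewrite (le_trans (ler_normB _ _))// mulr2n mulrDl mul1r lerD.
Qed.

(* The norm [sup_n |partial_sum n _|] is complete: the coordinates of a Cauchy sequence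
   converge, and uniqueness of expansions identifies their limits. *)
Lemma sums_bounded_limit (x : X) (u : nat -> X) (A : R) :
  u 0 = 0 -> u @ \oo --> x ->
  (forall k l, (k <= l)%N -> sums_bounded (A / 2 ^+ k) (u l - u k)) ->
  sums_bounded A x.
Proof.
move=> u0 ux ucauchy.
have coef_cvg i : cvgn (fun k => basis_coef (u k) i).
  have ei : 0 < `|e i| by rewrite normr_gt0 basis_neq0.
  apply/cauchy_cvgP/cauchyP => eps eps0.
  have [k kP] := half_geometric_small (2 * A / `|e i|) eps0.
  exists (basis_coef (u k) i); exists k => // l /= kl.
  have /(_ i) := basis_coef_le (ucauchy k l kl).
  rewrite addrC -scaleN1r basis_coef_linear mulN1r addrC -ler_pdivlMr// => h.
  rewrite -ball_normE /= distrC (le_lt_trans h)//.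
  by rewrite mulrA mulrAC.
pose b i : R := limn (fun k => basis_coef (u k) i).
pose S n : X := \sum_(0 <= i < n) b i *: e i.
have S_cvg n : (fun k => partial_sum n (u k)) @ \oo --> S n.
  rewrite /S; elim: n => [|n IHn].
    by rewrite big_nil; under eq_fun do rewrite /partial_sum big_nil; exact: cvg_cst.
  rewrite big_nat_recr//=; under eq_fun do rewrite /partial_sum big_nat_recr//=.
  by apply: cvgD => //; apply: cvgZl; exact: coef_cvg.
(* Let [l] tend to infinity in [ucauchy]. Uniformity in [n] is what the three-term estimate below
   relies on. *)
have S_close n k : `|S n - partial_sum n (u k)| <= A / 2 ^+ k.
  apply: (cvgr_to_le (cvg_norm (cvgB (S_cvg n) (cvg_cst (partial_sum n (u k)))))).
  by exists k => // l /= kl; have := ucauchy k l kl n; rewrite partial_sumB.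
have Sx : basis_coef x = b.
  apply: basis_coef_unique; apply/cvgrPdist_lt => eps eps0.
  have eps3 : 0 < eps / 3 by rewrite divr_gt0.
  move/cvgrPdist_lt : ux => /(_ _ eps3)[m _ um].
  have [k kP] := half_geometric_small A eps3.
  pose p := maxn m k.
  have pP : A / 2 ^+ p < eps / 3.
    apply: le_lt_trans kP; rewrite ler_wpM2l ?lef_pV2 ?posrE ?exprn_gt0//.
      (* This yields 0 <= A, since [A] bounds a norm. *)
      have := S_close 0 0; rewrite expr0 divr1; exact: le_trans.
    by rewrite ler_weXn2l ?leq_maxr// ler1n.
  move/cvgrPdist_lt : (@partial_sum_cvg (u p)) => /(_ _ eps3); apply: filterS => n np.
  have := um p (leq_maxl _ _); have := S_close n p; rewrite distrC => h1 /= h2.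
  have -> : x - series (fun i => b i *: e i) n =
      (x - u p) + (u p - partial_sum n (u p)) + (partial_sum n (u p) - S n).
    by rewrite !subrKA.
  apply: le_lt_trans (ler_normD _ _) _.
  apply: le_lt_trans (lerD (ler_normD _ _) (lexx _)) _.
  move: np h1 h2 pP; lra.
move=> n; rewrite /partial_sum Sx -/(S n).
by have := S_close n 0; rewrite u0 partial_sum0 subr0 expr0 divr1.
Qed.

(** Successive approximation: subtracting [G] halves the norm of the remainder [y k], so the sums x
    - y k of corrections converge to [x] and are Cauchy for the sup norm of partial sums. *)
Lemma partial_sum_bounded : exists2 K : R, 0 <= K & forall n x, `|partial_sum n x| <= K * `|x|.
Proof.
have [C C0 approx] := sums_bounded_approx.
have /choice[G GP] : forall y : X, exists u,
    sums_bounded (C * `|y|) u /\ `|y - u| <= `|y| / 2.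
  move=> y; have [->|y0] := eqVneq y 0.
    by exists 0; split; [move=> n; rewrite partial_sum0 !normr0 mulr0|rewrite subrr normr0 mul0r].
  have [|u ? ?] := approx y (`|y| / 2); first by rewrite divr_gt0// normr_gt0.
  by exists u; split=> //; exact: ltW.
exists (2 * C); first by rewrite mulr_ge0// ltW.
move=> n x; pose y k := iter k (fun y => y - G y) x.
have y_le k : `|y k| <= `|x| / 2 ^+ k.
  elim: k => [|k IHk]; first by rewrite expr0 divr1.
  have [_ /le_trans -> //] := GP (y k).
  by rewrite exprSr invfM mulrA ler_wpM2r.
apply: (@sums_bounded_limit x (fun k => x - y k)) => [||k l kl].
- by rewrite /y subrr.
- rewrite -[X in _ --> X]subr0; apply: cvgB; first exact: cvg_cst.
  apply/cvgrPdist_lt => eps eps0; have [k kP] := half_geometric_small `|x| eps0.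
  exists k => // l /= kl; rewrite sub0r normrN (le_lt_trans (y_le l))//.
  by apply: le_lt_trans kP; rewrite ler_wpM2l// lef_pV2 ?posrE ?exprn_gt0// ler_weXn2l// ler1n.
- rewrite opprB addrC addrA addrNK.
  (* The corrections from k to l - 1 have bounds C |x| / 2 ^ j, a geometric sum. *)
  suff h : sums_bounded (2 * C * `|x| * (2 ^- k - 2 ^- l)) (y k - y l).
    apply: sums_boundedW h; rewrite ler_wpM2l ?mulr_ge0 ?(ltW C0)//.
    by rewrite gerBl invr_ge0 exprn_ge0.
  rewrite -(subnK kl); elim: (l - k)%N => [|j IHj].
    by rewrite add0n !subrr mulr0 => i; rewrite partial_sum0 normr0.
  move=> i; rewrite addSn.
  have -> : y k - y (j + k).+1 = y k - y (j + k)%N + G (y (j + k)%N).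
    by rewrite /y iterS opprB addrCA addrC.
  rewrite -[X in _ + X](scale1r) addrC partial_sum_linear scale1r (le_trans (ler_normD _ _))//.
  have [/(_ i) h _] := GP (y (j + k)%N).
  apply: le_trans (lerD h (IHj i)) _.
  apply: le_trans (lerD (ler_wpM2l (ltW C0) (y_le _)) (lexx _)) _.
  rewrite exprS invfM le_eqVlt; apply/orP; left; apply/eqP; field.
  by rewrite !expf_neq0.
Qed.

(** Uniqueness of expansions identifies the coefficients of a finite sum, so its [n]-th partial sum
    is its truncation. *)
Lemma basis_inequality : exists2 K : R, 0 <= K &
  forall n m (a : nat -> R), (n <= m)%N ->
    `|\sum_(i < n) a i *: e i| <= K * `|\sum_(i < m) a i *: e i|.
Proof.
have [K K0 hK] := partial_sum_bounded; exists K => // n m a nm.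
have aE : basis_coef (\sum_(i < m) a i *: e i) = fun i => if (i < m)%N then a i else 0.
  apply: basis_coef_unique; apply: cvg_near_cst; exists m => // l /= ml.
  rewrite /series/= (big_cat_nat (leq0n m) ml)//= [X in _ + X]big_nat_cond.
  rewrite [X in _ + X]big1 ?addr0 => [|i]; last first.
    by rewrite andbT => /andP[mi _]; rewrite ltnNge mi scale0r.
  by rewrite big_mkord; apply: eq_bigr => i _; rewrite ltn_ord.
have := hK n (\sum_(i < m) a i *: e i); rewrite /partial_sum aE big_mkord.
rewrite (eq_bigr (fun i : 'I_n => a i *: e i))// => i _.
by rewrite (leq_trans (ltn_ord i) nm).
Qed.
End PartialSumBound.

(** * From the NQP to the half-integer net *)

Lemma semi_normalized_bounds (R : realType) (X : normedModType R) (e : nat -> X) :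
  semi_normalized e -> exists a b : R, 0 < a /\ forall i, a <= `|e i| <= b.
Proof.
move=> [inf0 supy].
have [a a0 ha] : exists2 a : R, 0 < a & forall i, a <= `|e i|.
  have lb i : (ereal_inf (range (fun i => `|e i|%:E)) <= `|e i|%:E)%E.
    by apply: ereal_inf_lbound; exists i.
  move: inf0 lb; case: (ereal_inf _) => [r||] //= r0 lb.
    by exists r => // i; rewrite -lee_fin.
  (* An infimum +oo is impossible, as it would lie below |e 0|. *)
  by have := lb 0; rewrite leye_eq.
have [b hb] : exists b : R, forall i, `|e i| <= b.
  have ub i : (`|e i|%:E <= ereal_sup (range (fun i => `|e i|%:E)))%E.
    by apply: ereal_sup_ubound; exists i.
  move: supy ub; case: (ereal_sup _) => [r||] //= r0 ub.
    by exists r => // i; rewrite -lee_fin.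
  by have := ub 0; rewrite leeNy_eq.
by exists a, b; split=> // i; rewrite ha hb.
Qed.

(** Approximating the sum of s_i (delta / 2) e_i leaves an error with coefficients (s_i - 2 k_i)
    delta / 2, of the right parity; truncating it to the first [n] terms costs the factor [K]. *)
Lemma NQP_half_net (R : realType) (X : normedModType R) (e : nat -> X) (K : R) :
  0 <= K ->
  (forall n m (a : nat -> R), (n <= m)%N ->
    `|\sum_(i < n) a i *: e i| <= K * `|\sum_(i < m) a i *: e i|) ->
  NQP e -> exists delta C : R, 0 < delta /\
    forall n (s : nat -> bool), exists z : nat -> int,
      (forall i, odd `|z i|%N = s i) /\
      `|\sum_(i < n) (z i)%:~R *: (delta *: e i)| <= C.
Proof.
move=> K0 basisK [eps [delta [eps0 delta0 net]]].
exists (delta / 2), (K * eps); split; first by rewrite divr_gt0.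
move=> n s; pose a (i : nat) : R := (s i)%:R * (delta / 2).
have [k kfin kP] := net `I_n a (finite_II n).
have [m nm km] : exists2 m, (n <= m)%N & forall i, k i != 0 -> (i < m)%N.
  have /finite_seqP[r rk] := kfin.
  exists (maxn n (\max_(i <- r) i).+1); first exact: leq_maxl.
  move=> i ki; rewrite leq_max ltnS; apply/orP; right.
  have : [set i | k i != 0] i by [].
  by rewrite rk /= => ir; exact: leq_bigmax_seq.
(* Beyond [n] only the parity of z_i matters. *)
exists (fun i => if (i < n)%N then (s i)%:Z - 2 * k i else (s i)%:Z); split.
  by move=> i; case: ifP => _; case: (s i); lia.
rewrite (@fsbig_widen _ _ _ _ [set i | k i != 0] `I_m) in kP; last 2 first.
- by move=> i /= /km.
- by move=> i /= [_ /negP]; rewrite negbK => /eqP ->; rewrite mul0r scale0r.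
rewrite -!fsbig_ord in kP.
pose c i : R := (if (i < n)%N then a i else 0) - (k i)%:~R * delta.
have cE : \sum_(i < n) a i *: e i - \sum_(i < m) ((k i)%:~R * delta) *: e i =
    \sum_(i < m) c i *: e i.
  rewrite (big_ord_widen m (fun i => a i *: e i))// big_mkcond -sumrB.
  by apply: eq_bigr => i _; rewrite /c scalerBl; case: ifP => //; rewrite scale0r.
apply: le_trans (ler_wpM2l K0 kP); rewrite cE; apply: le_trans (basisK _ _ _ nm).
rewrite le_eqVlt; apply/orP; left; apply/eqP; congr (`| _ |); apply: eq_bigr => i _.
rewrite ltn_ord scalerA /c ltn_ord /a intrD intrN intrM -pmulrn; congr (_ *: _).
by field.
Qed.

Lemma no_semi_normalized_NQP_basis (R : realType) (X : completeNormedModType R) :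
  nontrivial_cotype X ->
  ~ exists e : nat -> X, [/\ schauder_basis e, semi_normalized e & NQP e].
Proof.
move=> [q [q2 [c cotype_c]]] [e [eb /semi_normalized_bounds[a [b [a0 ab]]] eN]].
have [K K0 basisK] := basis_inequality eb.
have [delta [C [delta0 net]]] := NQP_half_net K0 basisK eN.
have q0 : 0 < q by lra.
(* In [kappa], 2 K bounds a difference of consecutive initial sums and delta a bounds the rescaled
   basis vectors from below. *)
apply: (half_net_cotype_false (e := fun i => delta *: e i) (b := delta * b)
  (kappa := 2 * K / (delta * a)) _ _ net q0 cotype_c).
- by move=> i; rewrite /= normrZ gtr0_norm// ler_pM2l//; case/andP: (ab i).
- move=> n x i ni; rewrite mulrAC ler_pdivlMr ?mulr_gt0// mulrA.
  apply: (@le_trans _ _ (`|x i *: (delta *: e i)|)).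
    rewrite scalerA normrZ normrM [`|delta|]gtr0_norm// ler_wpM2l//.
      by rewrite mulr_ge0// ltW.
    by case/andP: (ab i).
  pose y j := x j * delta.
  have yE k : \sum_(j < k) x j *: (delta *: e j) = \sum_(j < k) y j *: e j.
    by apply: eq_bigr => j _; rewrite scalerA.
  have -> : x i *: (delta *: e i) = \sum_(j < i.+1) y j *: e j - \sum_(j < i) y j *: e j.
    by rewrite big_ord_recr /= scalerA [X in X - _]addrC addrK.
  rewrite yE (le_trans (ler_normB _ _))// -mulrA mulr2n mulrDl mul1r lerD//.
    exact: basisK.
  by apply: basisK; exact: ltnW.
Qed.

(** * Cotype of l1 *)

Section Khintchine.
Variable R : realType.

Definition rademacher_sum n (a : 'I_n -> R) (s : {ffun 'I_n -> bool}) : R :=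
  \sum_(i < n) (-1) ^+ s i * a i.

Lemma sum_cube_recl n (F : {ffun 'I_n.+1 -> bool} -> R)
    (cons := fun b (s : {ffun 'I_n -> bool}) =>
      [ffun i => if unlift ord0 i is Some j then s j else b] : {ffun 'I_n.+1 -> bool}) :
  \sum_s F s = \sum_s (F (cons true s) + F (cons false s)).
Proof.
rewrite (reindex (fun u : bool * {ffun 'I_n -> bool} => cons u.1 u.2)) /=; last first.
  exists (fun s => (s ord0, [ffun j => s (lift ord0 j)])) => [[b s]|s] _ /=.
    rewrite /cons ffunE unlift_none; congr (_, _).
    by apply/ffunP => j; rewrite !ffunE liftK.
  apply/ffunP => i; rewrite /cons !ffunE.
  by case: unliftP => [j ->|->]; rewrite ?ffunE.
rewrite -(pair_bigA _ (fun b s => F (cons b s))) /=.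
by rewrite big_bool /= big_split.
Qed.

Lemma rademacher_sum_recl n (a : 'I_n.+1 -> R) (G : R -> R) :
  \sum_s G (rademacher_sum a s) =
  \sum_s (G (- a ord0 + rademacher_sum (a \o lift ord0) s) +
          G (a ord0 + rademacher_sum (a \o lift ord0) s)).
Proof.
rewrite (sum_cube_recl (fun s => G (rademacher_sum a s))).
apply: eq_bigr => s _; rewrite /rademacher_sum.
congr (G _ + G _); rewrite big_ord_recl ffunE unlift_none ?expr0 ?expr1 ?mulN1r ?mul1r.
  by congr (_ + _); apply: eq_bigr => i _; rewrite ffunE liftK.
by congr (_ + _); apply: eq_bigr => i _; rewrite ffunE liftK.
Qed.

Lemma sum_rademacher_sqr n (a : 'I_n -> R) :
  \sum_s rademacher_sum a s ^+ 2 = 2 ^+ n * \sum_i a i ^+ 2.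
Proof.
elim: n a => [|n IHn] a.
  rewrite big_ord0 mulr0 big1// => s _.
  by rewrite /rademacher_sum big_ord0 expr0n.
rewrite (rademacher_sum_recl a (fun x => x ^+ 2)) big_ord_recl /=.
rewrite (eq_bigr (fun s =>
  2 * a ord0 ^+ 2 + 2 * rademacher_sum (a \o lift ord0) s ^+ 2)) => [|s _];
  last by rewrite /=; ring.
rewrite big_split/= -[X in _ + X]mulr_sumr IHn sumr_const card_ffun card_bool card_ord.
by rewrite -(mulr_natl _ (2 ^ n)) natrX [2 ^+ n.+1]exprS /=; ring.
Qed.

(** Summing over the first sign gives 2 x ^ 4 + 12 x ^ 2 S ^ 2 + 2 S ^ 4. Its mixed term matches
    that of 6 (x ^ 2 + v) ^ 2, which has x ^ 4 to spare. *)
Lemma sum_rademacher_pow4 n (a : 'I_n -> R) :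
  \sum_s rademacher_sum a s ^+ 4 <= 3 * 2 ^+ n * (\sum_i a i ^+ 2) ^+ 2.
Proof.
elim: n a => [|n IHn] a.
  rewrite big1 => [|s _]; first by rewrite !mulr_ge0 ?exprn_ge0// big_ord0.
  by rewrite /rademacher_sum big_ord0 expr0n.
rewrite (rademacher_sum_recl a (fun x => x ^+ 4)) big_ord_recl /=.
rewrite (eq_bigr (fun s => 2 * a ord0 ^+ 4 +
    (12 * a ord0 ^+ 2 * rademacher_sum (a \o lift ord0) s ^+ 2 +
     2 * rademacher_sum (a \o lift ord0) s ^+ 4))) => [|s _]; last by rewrite /=; ring.
rewrite !big_split/= -!mulr_sumr.
rewrite sum_rademacher_sqr sumr_const card_ffun card_bool card_ord.
rewrite -(mulr_natl _ (2 ^ n)) natrX [2 ^+ n.+1]exprS /=.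
have := IHn (a \o lift ord0); have : 0 <= 2 ^+ n :> R by rewrite exprn_ge0.
rewrite /=; move: (\sum_s _) (\sum_i _) (2 ^+ n) (a ord0) => f v t x t0 hf.
have := mulr_ge0 t0 (sqr_ge0 (x ^+ 2)); nra.
Qed.

(** The L1 Khintchine inequality, from the second and fourth moments: the summed pointwise bound has
    left side at least (12 - 3) 2 ^ n r ^ 4, and 8 suffices. *)
Lemma sum_sqr_le_sum_norm n (a : 'I_n -> R) :
  2 ^+ n * Num.sqrt (\sum_i a i ^+ 2) <= 2 * \sum_s `|rademacher_sum a s|.
Proof.
have [->|v0] := eqVneq (\sum_i a i ^+ 2) 0.
  by rewrite sqrtr0 mulr0 mulr_ge0// sumr_ge0.
have v_ge0 : 0 <= \sum_i a i ^+ 2 by apply: sumr_ge0 => i _; exact: sqr_ge0.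
have h4 := sum_rademacher_pow4 a; have h2 := sum_rademacher_sqr a.
move: v0 v_ge0 h2 h4; set v := \sum_i _ => v0 v_ge0 h2 h4.
have vE := sqr_sqrtr v_ge0.
have r0 : 0 < Num.sqrt v by rewrite sqrtr_gt0 lt_def v0.
move: vE r0; set r := Num.sqrt v => vE r0; rewrite -vE in h2 h4.
have t0 : 0 < 2 ^+ n :> R by rewrite exprn_gt0.
(* [|u| >= (3 u ^ 2 - u ^ 4) / 2] at [u = S / (2 r)] *)
have pointwise s : 12 * r ^+ 2 * rademacher_sum a s ^+ 2 - rademacher_sum a s ^+ 4 <=
    16 * r ^+ 3 * `|rademacher_sum a s|.
  set x := rademacher_sum a s.
  have x2 : x ^+ 2 = `|x| ^+ 2 by rewrite real_normK ?num_real.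
  rewrite (exprM x 2 2 : x ^+ 4 = _) x2; clearbody x.
  rewrite -subr_ge0 [leRHS](_ : _ = `|x| * (`|x| - 2 * r) ^+ 2 * (`|x| + 4 * r)); last by ring.
  apply: mulr_ge0; first by rewrite mulr_ge0// sqr_ge0.
  by apply: addr_ge0 => //; apply: mulr_ge0 => //; exact: ltW.
have : \sum_s (12 * r ^+ 2 * rademacher_sum a s ^+ 2 - rademacher_sum a s ^+ 4) <=
    \sum_s 16 * r ^+ 3 * `|rademacher_sum a s| by exact: ler_sum.
rewrite sumrB -!mulr_sumr h2 => h.
rewrite -(ler_pM2l (exprn_gt0 3 r0)).
have := mulr_gt0 t0 (exprn_gt0 4 r0).
move: h h4; set f := \sum_s _ ^+ 4; set g := \sum_s `|_|; set t := 2 ^+ n => h h4.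
clearbody f g t r; nra.
Qed.

End Khintchine.

(** Lagrange's identity. *)
Lemma cauchy_schwarz_sum (R : realDomainType) n (a b : 'I_n -> R) :
  (\sum_i a i * b i) ^+ 2 <= (\sum_i a i ^+ 2) * (\sum_i b i ^+ 2).
Proof.
rewrite -subr_ge0 -(pmulr_rge0 _ (ltr0n R 2)).
rewrite [leRHS](_ : _ = \sum_i \sum_j (a i * b j - a j * b i) ^+ 2).
  by apply: sumr_ge0 => i _; apply: sumr_ge0 => j _; exact: sqr_ge0.
rewrite [RHS](eq_bigr (fun i => \sum_j (a i ^+ 2 * b j ^+ 2) + \sum_j (b i ^+ 2 * a j ^+ 2) -
    2 * \sum_j (a i * b i) * (a j * b j))); last first.
  by move=> i _; rewrite mulr_sumr -big_split/= -sumrB; apply: eq_bigr => j _; ring.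
rewrite sumrB big_split/= -mulr_sumr expr2 -!big_distrlr/=; ring.
Qed.

Section Ell1Cotype.
Variable R : realType.

Lemma ell1_coord_sum n (c : 'I_n -> R) (v : 'I_n -> ell1 R) k :
  (\sum_i c i *: v i : ell1 R) k = \sum_i c i * v i k.
Proof. by elim/big_rec2: _ => // i y x _ <-. Qed.

(** Minkowski's inequality bounds [W] by the sum of the column norms [sigma k], Khintchine's
    inequality bounds each column by an average over signs, and Cauchy-Schwarz passes from the L1 to
    the L2 average. *)
Lemma ell1_truncated_cotype n (v : 'I_n -> ell1 R) m :
  \sum_i (\sum_(0 <= k < m) `|v i k|) ^+ 2 <=
  4 * (2 ^- n * \sum_(s : {ffun 'I_n -> bool}) `|\sum_(i < n) (-1) ^+ s i *: v i| ^+ 2).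
Proof.
pose w i := \sum_(0 <= k < m) `|v i k|; pose W := Num.sqrt (\sum_i w i ^+ 2).
pose sigma k := Num.sqrt (\sum_i v i k ^+ 2).
have w2 : 0 <= \sum_i w i ^+ 2 by apply: sumr_ge0 => i _; exact: sqr_ge0.
have WE : W ^+ 2 = \sum_i w i ^+ 2 by rewrite sqr_sqrtr.
have minkowski : W <= \sum_(0 <= k < m) sigma k.
  have [->|W0] := eqVneq W 0; first by apply: sumr_ge0 => k _; exact: sqrtr_ge0.
  have {}W0 : 0 < W by rewrite lt_def W0 sqrtr_ge0.
  (* Expand one factor of each w_i ^ 2 in W ^ 2, apply Cauchy-Schwarz for each [k], and cancel
     [W]. *)
  rewrite -(ler_pM2l W0) -expr2 WE.
  under eq_bigr do rewrite expr2 {2}/w mulr_sumr.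
  rewrite exchange_big mulr_sumr ler_sum// => k _ /=.
  apply: le_trans (ler_norm _) _; rewrite -sqrtr_sqr /W /sigma -sqrtrM// ler_wsqrtr//.
  apply: le_trans (cauchy_schwarz_sum _ _) _; rewrite le_eqVlt; apply/orP; left; apply/eqP.
  by congr (_ * _); apply: eq_bigr => i _; rewrite real_normK ?num_real.
pose T (s : {ffun 'I_n -> bool}) : R := `|\sum_(i < n) (-1) ^+ s i *: v i|.
have t0 : 0 < 2 ^+ n :> R by rewrite exprn_gt0.
have WT : 2 ^+ n * W <= 2 * \sum_s T s.
  apply: le_trans (ler_wpM2l (ltW t0) minkowski) _.
  rewrite mulr_sumr.
  apply: (@le_trans _ _ (\sum_(0 <= k < m) 2 * \sum_s `|rademacher_sum (fun i => v i k) s|)).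
    by apply: ler_sum => k _; exact: sum_sqr_le_sum_norm.
  rewrite -mulr_sumr ler_wpM2l// exchange_big ler_sum// => s _ /=.
  apply: le_trans (ell1_norm_ge _ m); apply: ler_sum => k _.
  by rewrite ell1_coord_sum.
have W_ge0 : 0 <= W by exact: sqrtr_ge0.
have TT : (\sum_s T s) ^+ 2 <= 2 ^+ n * \sum_s T s ^+ 2.
  by apply: le_trans (sqr_sum_le _) _; rewrite card_ffun card_bool card_ord natrX.
rewrite -[leLHS]WE -[\sum_s _]/(\sum_s T s ^+ 2) mulrCA ler_pdivlMl//.
rewrite -(ler_pM2l t0) mulrA -expr2 -exprMn.
apply: (@le_trans _ _ ((2 * \sum_s T s) ^+ 2)).
  have tW : 0 <= 2 ^+ n * W by rewrite mulr_ge0// ltW.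
  by rewrite lerXn2r// nnegrE// (le_trans tW WT).
have four : 2 ^+ 2 = 4 :> R by rewrite -natrX.
by rewrite exprMn four [leRHS]mulrCA ler_wpM2l.
Qed.

Lemma ell1_nontrivial_cotype : nontrivial_cotype (ell1 R).
Proof.
exists 2; split=> //; exists 2 => n v.
set S := 2 ^- n * _.
have S0 : 0 <= S by rewrite mulr_ge0 ?invr_ge0 ?exprn_ge0// sumr_ge0// => s _; exact: sqr_ge0.
rewrite powR12_sqrt; last by apply: sumr_ge0 => i _; exact: powR_ge0.
rewrite -[2 in leRHS](ger0_norm (ler0n R 2)) -sqrtr_sqr -sqrtrM ?sqr_ge0// ler_wsqrtr//.
under eq_bigr do rewrite -[2]/(2%:R) powR_mulrn//.
(* The truncated estimate is uniform in [m] and passes to the limit. *)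
have : (fun m => \sum_i (\sum_(0 <= k < m) `|v i k|) ^+ 2) @ \oo --> \sum_i `|v i| ^+ 2.
  elim: (index_enum _) => [|i r IHr].
    by rewrite big_nil; under eq_fun do rewrite big_nil; exact: cvg_cst.
  rewrite big_cons; under eq_fun do rewrite big_cons.
  by apply: cvgD => //; under eq_fun do rewrite expr2; rewrite expr2; apply: cvgM; exact: ell1_cvg.
move=> h; apply: (cvgr_to_le h); apply: nearW => m.
by rewrite -natrX; exact: ell1_truncated_cotype.
Qed.
End Ell1Cotype.

Theorem corollary5p15 (R : realType) :
  (forall X : completeNormedModType R,
     infinite_dimensional X -> nontrivial_cotype X ->
     ~ exists e : nat -> X,
         [/\ schauder_basis e, semi_normalized e & NQP e]) /\
  ~ exists e : nat -> ell1 R,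
      [/\ schauder_basis e, semi_normalized e & NQP e].
Proof.
split; first by move=> X _; exact: no_semi_normalized_NQP_basis.
exact: (no_semi_normalized_NQP_basis (ell1_nontrivial_cotype R)).
Qed.
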